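(* Let $q$ be a prime power, let $n\geq 2$, and let $\mathcal{C}\subseteq\mathbb{F}_q^n$ be a linear code with $\dim\mathcal{C}\geq 2$. Then \[ d_2(\mathcal{C}) \leq 2R_2(\mathcal{C})+2,\] and in particular, \[ \delta_2(\mathcal{C}) \leq R_2(\mathcal{C}).\]
   Context: A linear code $\mathcal{C}\subseteq\mathbb{F}_q^n$ is an $\mathbb{F}_q$-linear subspace. For a matrix $V\in\mathbb{F}_q^{t\times n}$, $\operatorname{wt}(V)$ is the number of non-zero columns of $V$, and $d(V,V')=\operatorname{wt}(V-V')$. For an integer $t\geq 1$, $\mathcal{C}^t$ is the set of matrices in $\mathbb{F}_q^{t\times n}$ all of whose rows are in $\mathcal{C}$. For $1\leq t\leq\dim\mathcal{C}$, the $t$-th generalized Hamming weight is $d_t(\mathcal{C})=\min\{\operatorname{wt}(C): C\in\mathcal{C}^t,\ \operatorname{rank} C=t\}$, and $\delta_t(\mathcal{C})=\lfloor (d_t(\mathcal{C})-1)/2\rfloor$. The $t$-th generalized covering radius is $R_t(\mathcal{C})=\max_{V\in\mathbb{F}_q^{t\times n}}\min_{C\in\mathcal{C}^t} d(V,C)$. *)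

(* Defs.v *)
From mathcomp Require Import all_boot all_order all_algebra.

Set Implicit Arguments.
Unset Strict Implicit.
Unset Printing Implicit Defensive.

Import GRing.Theory.
Local Open Scope ring_scope.

Definition mx_wt (F : finFieldType) (t n : nat) (V : 'M[F]_(t, n)) : nat :=
  #|[set j : 'I_n | col j V != 0]|.

Definition mx_dist (F : finFieldType) (t n : nat) (V W : 'M[F]_(t, n)) : nat :=
  mx_wt (V - W).

Definition code_power (F : finFieldType) (n : nat) (C : {vspace 'rV[F]_n})
    (t : nat) : {set 'M[F]_(t, n)} :=
  [set M | [forall i, row i M \in C]].

(* In the minima below the default value n is harmless: weights of matrices
   with n columns are at most n, so it never changes a minimum over a nonempty
   set.  The set in gen_weight is nonempty exactly when t <= \dim C, and
   code_power C t always contains 0. *)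
Definition gen_weight (F : finFieldType) (n : nat) (C : {vspace 'rV[F]_n})
    (t : nat) : nat :=
  \big[minn/n]_(M in code_power C t | \rank M == t) mx_wt M.

(* For t >= 1 the weight is positive whenever it is a genuine minimum, so the
   truncated subtraction agrees with the integer one. *)
Definition gen_packing_radius (F : finFieldType) (n : nat)
    (C : {vspace 'rV[F]_n}) (t : nat) : nat :=
  ((gen_weight C t - 1) %/ 2)%N.

Definition gen_covering_radius (F : finFieldType) (n : nat)
    (C : {vspace 'rV[F]_n}) (t : nat) : nat :=
  \max_(V : 'M[F]_(t, n)) \big[minn/n]_(M in code_power C t) mx_dist V M.

(* Main.v *)
Require Import Defs.
From mathcomp Require Import all_boot all_order all_algebra.
From mathcomp Require Import zify.

(** Write R for the covering radius R_2 and suppose d_2 >= 2R+3, so that every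
    M in C^2 with wt M <= 2R+2 has rank at most 1.  Let T be a set of R+2
    coordinates, split into two nearly equal halves, and let V have column e_1
    on the first half, e_2 on the second and 0 outside T.  A matrix M of C^2
    within R of V has weight at most 2R+2, and it is not 0, so M = u c^T with
    c in C.  As u is parallel to at most one of e_1, e_2, agreement of V and M
    on T happens inside one half only; counting errors shows that c meets T
    and that 2 |supp c \ T| < R.  Among all such pairs (T, c), take one with
    |T ∩ supp c| minimal, and exchange a point of T ∩ supp c for a point
    outside T ∪ supp c.  The new set T' has its own word c', which by
    minimality is not a multiple of c; but
    |supp c ∪ supp c'| <= |T ∪ T'| + |supp c \ T| + |supp c' \ T'| <= 2R+2,
    contradicting d_2 >= 2R+3. *)

Set Implicit Arguments.
Unset Strict Implicit.
Unset Printing Implicit Defensive.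

Import Order.TTheory GRing.Theory.
Local Open Scope ring_scope.

Lemma exists_subset_card (T : finType) (A : {set T}) (k : nat) :
  (k <= #|A|)%N -> exists2 B : {set T}, B \subset A & #|B| = k.
Proof.
case/card_geqP => s [us <- sA]; exists [set x in s].
  by apply/subsetP => x; rewrite inE => /sA.
by rewrite cardsE; apply/card_uniqP.
Qed.

Definition mx_supp (F : finFieldType) (t n : nat) (M : 'M[F]_(t, n)) :=
  [set j | col j M != 0].

Lemma mx_wtE (F : finFieldType) (t n : nat) (M : 'M[F]_(t, n)) :
  mx_wt M = #|mx_supp M|.
Proof. by []. Qed.

Lemma mx_suppPn (F : finFieldType) (t n : nat) (M : 'M[F]_(t, n)) j :
  reflect (forall i, M i j = 0) (j \notin mx_supp M).
Proof.
rewrite inE negbK; apply: (iffP eqP) => [/colP h i | h].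
  by have := h i; rewrite !mxE.
by apply/colP => i; rewrite !mxE.
Qed.

Lemma outer_mxE (R : pzSemiRingType) (m n : nat) (u : 'cV[R]_m)
    (c : 'rV[R]_n) i j : (u *m c) i j = u i 0 * c 0 j.
Proof. by rewrite mxE big_ord1. Qed.

Lemma mx_supp_outer (F : finFieldType) (t n : nat) (u : 'cV[F]_t)
    (c : 'rV[F]_n) : u != 0 -> mx_supp (u *m c) = mx_supp c.
Proof.
move=> u0; apply/setP => j; apply/negb_inj; apply/mx_suppPn/mx_suppPn => h i.
  have /cV0Pn[k uk] := u0; apply/eqP; have /eqP := h k.
  by rewrite outer_mxE mulf_eq0 (negPf uk) /= [i]ord1.
by rewrite outer_mxE h mulr0.
Qed.

Lemma mx_wt_triangle (F : finFieldType) (t n : nat) (V M : 'M[F]_(t, n)) :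
  (mx_wt M <= mx_wt V + mx_wt (V - M))%N.
Proof.
rewrite !mx_wtE.
apply: leq_trans (leq_card_setU _ _); apply/subset_leq_card/subsetP => j.
apply: contraTT; rewrite in_setU negb_or => /andP[/mx_suppPn hV /mx_suppPn hB].
apply/mx_suppPn => i; have := hB i; rewrite !mxE hV => /eqP.
by rewrite sub0r oppr_eq0 => /eqP.
Qed.

(** A nonzero row forces the rank to be exactly 1, so that row spans the row space and [u] collects
    the coefficients. *)
Lemma rank_neq2_outer (F : finFieldType) (n : nat) (M : 'M[F]_(2, n)) i :
  \rank M != 2 -> row i M != 0 -> exists u : 'cV_2, M = u *m row i M.
Proof.
move=> rM ri; apply/submxP.
rewrite -(mxrank_leqif_sup (row_sub i M)) rank_rV ri.
have := rank_leq_row M; have := mxrankS (row_sub i M); rewrite rank_rV ri.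
by move: (\rank M) rM => [|[|[|]]].
Qed.

Lemma gen_weight_le_size (F : finFieldType) (n : nat) (C : {vspace 'rV[F]_n})
    (t : nat) : (gen_weight C t <= n)%N.
Proof.
by have /bigmin_geP[] := lexx (gen_weight C t).
Qed.

Lemma gen_weight_le (F : finFieldType) (n : nat) (C : {vspace 'rV[F]_n})
    (t : nat) (M : 'M[F]_(t, n)) :
  M \in code_power C t -> \rank M = t -> (gen_weight C t <= mx_wt M)%N.
Proof.
move=> MC rM; have /bigmin_geP[_] := lexx (gen_weight C t).
by apply; rewrite MC rM /=.
Qed.

Lemma exists_codeword_near (F : finFieldType) (n : nat)
    (C : {vspace 'rV[F]_n}) (t : nat) (V : 'M[F]_(t, n)) :
  exists2 M, M \in code_power C t & (mx_wt (V - M) <= gen_covering_radius C t)%N.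
Proof.
have C0 : 0 \in code_power C t.
  by rewrite inE; apply/forallP => i; rewrite row0 mem0v.
set R := gen_covering_radius C t.
have [/exists_inP//|] := boolP [exists M in code_power C t, mx_wt (V - M) <= R]%N.
rewrite negb_exists_in => /forall_inP far.
have := leq_bigmax (F := fun V : 'M[F]_(t, n) =>
  \big[minn/n]_(M in code_power C t) mx_dist V M) V.
rewrite -/(gen_covering_radius C t) -/R leqNgt => /negP[].
apply: (big_ind (fun m => R < m)%N) => [|a b Ra Rb|M /far].
(* The default value [n] also exceeds [R]: the zero matrix is far from [V] too, yet at distance at
   most [n]. *)
- apply: (@leq_trans (mx_wt (V - 0))); first by rewrite ltnNge far.
  by rewrite -[leqRHS]card_ord max_card.
- by rewrite leq_min Ra.
- by rewrite -ltnNge.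
Qed.

Lemma card_supp_pair (F : finFieldType) (n : nat) (C : {vspace 'rV[F]_n})
    (c c' : 'rV[F]_n) :
  c \in C -> c' \in C -> c != 0 -> c' != 0 -> mx_supp c' != mx_supp c ->
  (gen_weight C 2 <= #|mx_supp c :|: mx_supp c'|)%N.
Proof.
move=> cC c'C c0 c'0 neq.
pose M : 'M[F]_(2, n) := \matrix_i (if i == 0 then c else c').
have M0 : row 0 M = c by rewrite rowK.
have M1 : row 1 M = c' by rewrite rowK.
have rM : \rank M = 2.
  (* Otherwise [c'] would be a nonzero multiple of [c] and have the same support. *)
  apply/eqP/negPn/negP => /(@rank_neq2_outer _ _ _ 0); rewrite M0.
  case=> // u eM; case/negP: neq; apply/eqP.
  have ec' : c' = row 1 u *m c by rewrite -M1 {1}eM row_mul.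
  rewrite ec' mx_supp_outer //; apply: contraNneq c'0 => u0.
  by rewrite ec' u0 mul0mx.
apply: leq_trans (gen_weight_le _ rM) _.
  by rewrite inE; apply/forallP => i; rewrite rowK; case: ifP.
rewrite mx_wtE; apply/subset_leq_card/subsetP => j jM.
apply: contraTT jM; rewrite in_setU negb_or => /andP[/mx_suppPn h /mx_suppPn h'].
by apply/mx_suppPn => i; rewrite mxE; case: ifP.
Qed.

Lemma exists_concentrated_word (F : finFieldType) (n : nat)
    (C : {vspace 'rV[F]_n}) (T : {set 'I_n}) :
  let R := gen_covering_radius C 2 in
  (2 * R + 2 < gen_weight C 2)%N -> #|T| = R.+2 ->
  exists c, [/\ c \in C, T :&: mx_supp c != set0 &
                (2 * #|mx_supp c :\: T| < R)%N].
Proof.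
move=> R dR cT.
have [A AT cA] : exists2 A : {set 'I_n}, A \subset T & #|A| = (R.+2)./2.
  by apply: exists_subset_card; lia.
have cTA : #|T :\: A| = (R.+2 - (R.+2)./2)%N.
  by rewrite cardsD (setIidPr AT) cT cA.
pose V : 'M[F]_(2, n) :=
  \matrix_(i, j) ((j \in T) && ((j \in A) == (i == 0)))%:R.
have sV : mx_supp V = T.
  apply/setP => j; apply/negb_inj; apply/mx_suppPn/idP => [h | jT i].
    apply/negP => jT; case jA: (j \in A).
      by have /eqP := h 0; rewrite mxE jT jA /= oner_eq0.
    by have /eqP := h 1; rewrite mxE jT jA /= oner_eq0.
  by rewrite mxE (negPf jT).
have wV : mx_wt V = R.+2 by rewrite -cT -sV.
have [M MC wM] := exists_codeword_near C V; rewrite -/R in wM.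
have rM : \rank M != 2.
  apply/negP => /eqP /(gen_weight_le MC) /(leq_trans dR).
  have := leq_trans (mx_wt_triangle V M) (leq_add (eq_leq wV) wM).
  lia.
(* This is where [T] must have more than [R] points. *)
have M0 : M != 0 by apply: contraTneq wM => ->; rewrite subr0 wV; lia.
have /existsP[k Mk] : [exists k, row k M != 0].
  apply: contraR M0; rewrite negb_exists => /forallP h.
  by apply/eqP/row_matrixP => k; rewrite row0; apply/eqP; rewrite -[_ == _]negbK.
have [u eM] := rank_neq2_outer rM Mk.
set c := row k M in eM Mk.
have u0 : u != 0 by apply: contraNneq M0 => u0; rewrite eM u0 mul0mx.
have cC : c \in C by move: MC; rewrite inE => /forallP/(_ k).
clearbody c.
(* The points of [T] where [V] and [M] agree. *)
pose E := T :\: mx_supp (V - M).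
have ET : E \subset T by apply: subsetDl.
have EM j i : j \in E -> u i 0 * c 0 j = V i j.
  rewrite in_setD => /andP[/mx_suppPn h _]; have /eqP := h i.
  by rewrite eM mxE [in X in _ + X]mxE outer_mxE subr_eq0 => /eqP.
have Ec : E \subset T :&: mx_supp c.
  apply/subsetP => j jE; have jT := subsetP ET _ jE.
  rewrite in_setI jT /=; apply/negPn/negP => /mx_suppPn h.
  move: jT; rewrite -sV; apply/negP/mx_suppPn => i.
  by rewrite -EM // h mulr0.
(* The lower entry of [u] decides which half contains [E]; the bound is the size of the larger
   half. *)
have cE : (#|E| <= R.+2 - (R.+2)./2)%N.
  have [u1 | u1] := eqVneq (u 1 0) 0.
    have : E \subset A.
      apply/subsetP => j jE; apply/negPn/negP => jA.
      have jT := subsetP ET _ jE; have := EM _ 1 jE.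
      by rewrite u1 mul0r mxE jT (negPf jA) /= => /eqP; rewrite eq_sym oner_eq0.
    by move/subset_leq_card; rewrite cA; lia.
  rewrite -cTA; apply/subset_leq_card/subsetP => j jE.
  have := EM _ 1 jE; have : j \in mx_supp c.
    by have := subsetP Ec _ jE; rewrite in_setI => /andP[].
  have jT := subsetP ET _ jE; rewrite in_setD jT andbT => jc e.
  apply: contraTN jc => jA; apply/mx_suppPn => i; rewrite [i]ord1.
  by move/eqP: e; rewrite mxE jT jA /= mulf_eq0 (negPf u1) => /eqP.
(* Two disjoint sets of errors: disagreements inside [T], and points outside [T] where [V] vanishes
   but [M] does not. *)
have cD : (#|T :\: E| + #|mx_supp c :\: T| <= R)%N.
  apply: leq_trans wM; rewrite mx_wtE -cardsUI.
  have -> : (T :\: E) :&: (mx_supp c :\: T) = set0.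
    apply/setP => j; rewrite !in_setI !in_setD in_set0.
    by case: (j \in T); rewrite ?andbF.
  rewrite cards0 addn0; apply/subset_leq_card/subsetP => j.
  rewrite in_setU !in_setD.
  case jT: (j \in T); first by rewrite /= andbT orbF andbT negbK.
  rewrite andbF /=; apply: contraTT => /mx_suppPn h.
  rewrite -(mx_supp_outer c u0) -eM; apply/mx_suppPn => i.
  have := h i; rewrite !mxE jT /= => /eqP.
  by rewrite sub0r oppr_eq0 => /eqP.
have := cardsID E T; rewrite (setIidPr ET) cT => cTE.
(* By [cE], at least [(R.+2)./2] errors lie in [T], leaving fewer than R/2 outside. By [cD], [E] has
   at least 2 points, so [c] meets [T]. *)
exists c; split => //; last by lia.
by rewrite -card_gt0; apply: leq_trans (subset_leq_card Ec); lia.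
Qed.

Lemma gen_weight2_le (F : finFieldType) (n : nat) (C : {vspace 'rV[F]_n}) :
  (gen_weight C 2 <= 2 * gen_covering_radius C 2 + 2)%N.
Proof.
rewrite leqNgt; apply/negP => dR; set R := gen_covering_radius C 2 in dR.
have nR : (2 * R + 2 < n)%N := leq_trans dR (gen_weight_le_size C 2).
suff none k (T : {set 'I_n}) c : #|T| = R.+2 -> c \in C ->
    T :&: mx_supp c != set0 -> (2 * #|mx_supp c :\: T| < R)%N ->
    #|T :&: mx_supp c| = k -> False.
  have [|T _ cT] := @exists_subset_card _ [set: 'I_n] R.+2.
    by rewrite cardsT card_ord; lia.
  have [c [cC Tc bc]] := exists_concentrated_word dR cT.
  exact: (none _ T c).
(* The minimal choice of the pair becomes a descent on [k]. *)
elim/ltn_ind: k T c => k IH T c cT cC /set0Pn[x xTc] bc ck.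
have [y yTc] : exists y, y \in ~: (T :|: mx_supp c).
  apply/set0Pn; rewrite -card_gt0 cardsCs setCK card_ord subn_gt0.
  have -> : T :|: mx_supp c = T :|: (mx_supp c :\: T).
    by apply/setP => j; rewrite !inE; case: (j \in T).
  apply: leq_ltn_trans (leq_card_setU _ _) _; rewrite cT.
  by move: #|_ :\: T| bc => b bc; lia.
move: xTc yTc; rewrite in_setI in_setC in_setU negb_or.
move=> /andP[xT xc] /andP[yT yc].
pose T' := y |: (T :\ x).
have yTx : y \notin T :\ x by rewrite in_setD1 negb_and yT orbT.
have cT' : #|T'| = R.+2.
  by rewrite cardsU1 yTx -cT (cardsD1 x T) xT.
have [c' [c'C Tc' bc']] := exists_concentrated_word dR cT'.
have supp_neq0 (U : {set 'I_n}) (v : 'rV[F]_n) j : j \in U :&: mx_supp v -> v != 0.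
  rewrite in_setI => /andP[_]; apply: contraTneq => ->.
  by apply/mx_suppPn => i; rewrite mxE.
have c0 : c != 0 by apply: (supp_neq0 T _ x); rewrite in_setI xT.
have c'0 : c' != 0 by have /set0Pn[z /supp_neq0] := Tc'.
(* With equal supports, trading [x] for [y] lowers the intersection by one, so the descent
   applies. *)
have [e | neq] := eqVneq (mx_supp c') (mx_supp c).
  apply: (IH #|T' :&: mx_supp c'| _ T' c') => //.
  rewrite e -ck (cardsD1 x (T :&: mx_supp c)) in_setI xT xc add1n ltnS.
  apply/subset_leq_card/subsetP => j; rewrite !in_setI in_setD1 in_setU1 in_setD1.
  case: eqP => [-> | _]; first by rewrite (negPf yc) andbF.
  by rewrite in_setI andbA.
have := card_supp_pair cC c'C c0 c'0 neq.
(* Both excesses are below R/2, so they add up to at most R - 1 and the union has at most 2R + 2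
   points. *)
suff : (#|mx_supp c :|: mx_supp c'| <=
        R.+3 + (#|mx_supp c :\: T| + #|mx_supp c' :\: T'|))%N by lia.
have <- : #|y |: T| = R.+3 by rewrite cardsU1 yT cT.
apply: leq_trans (leq_add (leqnn _) (leq_card_setU _ _)).
apply: leq_trans (leq_card_setU _ _).
apply/subset_leq_card/subsetP => j; rewrite !(in_setU, in_setD, in_set1).
by case: (j \in T); case: (j == y); case: (j == x);
  case: (_ \in mx_supp c); case: (_ \in mx_supp c').
Qed.

Theorem theorem5 (F : finFieldType) (n : nat) (C : {vspace 'rV[F]_n})
    (hn : (2 <= n)%N) (hC : (2 <= \dim C)%N) :
  (gen_weight C 2 <= 2 * gen_covering_radius C 2 + 2)%N /\
  (gen_packing_radius C 2 <= gen_covering_radius C 2)%N.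
Proof.
have d2 := gen_weight2_le C; split => //.
(* Rounding down (2R + 1)/2 gives R. *)
rewrite /gen_packing_radius; lia.
Qed.
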